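(* Let $p$ and $q$ be prime numbers, and let $P(2,q)$ denote the subgroup of upper triangular matrices in $\mathrm{GL}(2,\mathbb{F}_q)$. Then every connected component of the $p$-local commensurability graph $\Gamma_p(P(2,q))$ is a complete graph or a star graph.
   Context: For a group $G$ and a prime $p$, the $p$-local commensurability graph $\Gamma_p(G)$ has as vertices all finite-index subgroups of $G$, and an edge is drawn between (distinct) $A$ and $B$ if $[A: A\cap B][B: A\cap B]$ is a power of $p$ (where $1=p^0$ counts as a power of $p$). A connected component $H$ of a graph is a star graph if every edge in $H$ is incident with a fixed vertex $v_c$ of $H$ (the center), and these are the only edges in $H$. A component is complete if any two distinct vertices in it are adjacent (a single vertex is a complete graph). *)

(* Defs.v *)
From mathcomp Require Import all_boot all_order all_algebra all_fingroup.
From mathcomp Require Import all_solvable.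

Set Implicit Arguments.
Unset Strict Implicit.
Unset Printing Implicit Defensive.

Import GroupScope.

Section Graphs.
Variables (T : finType) (e : rel T).
Implicit Type C : {set T}.

(* The component of x is its class under [connect e]; this is the usual
   notion because the relations [e] considered here are symmetric. *)
Definition is_component C : Prop := exists x, C = [set y | connect e x y].

Definition complete_on C : Prop := {in C &, forall x y, x != y -> e x y}.

(* To be used on a component: connectedness then makes the center adjacent to
   every other vertex. *)
Definition star_on C : Prop :=
  exists2 c, c \in C & {in C &, forall x y, e x y -> x = c \/ y = c}.

End Graphs.

Section Commensurability.
Variable gT : finGroupType.

(* Every subgroup of a finite group has finite index. *)
Definition subgroup_of (G : {group gT}) := {H : {group gT} | H \subset G}.

Variables (p : nat) (G : {group gT}).
Implicit Types A B : subgroup_of G.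

Definition commens_index A B : nat :=
  (#|val A : val A :&: val B| * #|val B : val A :&: val B|)%N.

(* For prime p, [p.-nat n] says that n is a power of p, including p ^ 0;
   see [local_commensP]. *)
Definition local_commens A B : bool :=
  (A != B) && p.-nat (commens_index A B).

Lemma local_commensP A B : prime p ->
  reflect (A <> B /\ exists k, commens_index A B = (p ^ k)%N)
          (local_commens A B).
Proof.
move=> p_pr; apply: (iffP andP) => [[/eqP AB /p_natP[k Ek]]|[/eqP AB [k Ek]]].
  by split=> //; exists k.
by split=> //; rewrite Ek pnatX pnat_id.
Qed.

Lemma local_commens_sym : symmetric local_commens.
Proof.
by move=> A B; rewrite /local_commens /commens_index eq_sym mulnC setIC.
Qed.

Lemma local_commens_irr : irreflexive local_commens.
Proof. by move=> A; rewrite /local_commens eqxx. Qed.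

End Commensurability.

Arguments local_commens {gT} p G A B.

Section Parabolic.
Variable q : nat.

(* [is_trig_mx] means lower triangular, hence the transpose. *)
Definition upper_GL2 : {set {'GL_2['F_q]}} :=
  [set g | is_trig_mx (GLval g)^T%R].

Lemma upper_GL2P (g : {'GL_2['F_q]}) :
  reflect (forall i j : 'I_2, (j < i)%N -> GLval g i j = 0%R)
          (g \in upper_GL2).
Proof.
rewrite inE; apply: (iffP is_trig_mxP) => [H i j ij|H i j ij].
  by have := H j i ij; rewrite mxE.
by rewrite mxE; apply: H.
Qed.

Lemma upper_GL2_group_set : group_set upper_GL2.
Proof.
apply/group_setP; split=> [|x y].
  by rewrite inE GL_1E trmx1 scalar_mx_is_trig.
move=> /upper_GL2P xU /upper_GL2P yU; apply/upper_GL2P=> i j ltji.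
rewrite GL_ME mxE big1 // => k _.
have [/xU->|leik] := ltnP k i; first by rewrite GRing.mul0r.
by rewrite yU ?GRing.mulr0 // (leq_trans ltji).
Qed.

Canonical upper_GL2_group := Group upper_GL2_group_set.

End Parabolic.

(* Main.v *)
Require Import Defs.
From mathcomp Require Import all_boot all_order all_algebra all_fingroup.
From mathcomp Require Import all_solvable all_field.

(** Let U be the unitriangular subgroup, normal in G = P(2,q), of order q and
    with G/U an abelian q'-group.
    If p <> q, a subgroup of p-power index in B <= G contains the normal
    q-subgroup B :&: U, hence the derived subgroup of B, so it is normal in B.
    Normality makes p-local commensurability transitive, and components are
    complete.
    If p = q, adjacent subgroups have the same image in the p'-group G/U, so
    the component of A is contained in the set of B with BU = AU.  Its only
    member containing U is AU; the others are p'-groups, pairwise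
    non-adjacent, so AU is the center of a star. *)

Set Implicit Arguments.
Unset Strict Implicit.
Unset Printing Implicit Defensive.

Import GroupScope.

(** * Indices and invariants along paths *)

Lemma local_commensE (gT : finGroupType) (p : nat) (G : {group gT})
    (A B : subgroup_of G) :
  local_commens p G A B =
    [&& A != B, p.-nat #|val A : val B| & p.-nat #|val B : val A|].
Proof.
by rewrite /local_commens /commens_index pnatM indexgI setIC indexgI.
Qed.

Lemma connect_invariant (T : finType) (rT : Type) (e : rel T) (f : T -> rT) :
  (forall x y, e x y -> f x = f y) -> forall x y, connect e x y -> f x = f y.
Proof.
move=> ef x y /connectP[s + ->] {y}.
by elim: s x => //= y s IHs x /andP[/ef-> /IHs].
Qed.

(** Normality makes the image of [A :&: B] in [B / (B :&: D)] a subgroup, so [#|A :&: B : B :&: D|]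
    divides [#|B : D|]. Multiplying by [#|A : B|] gives the index in [A] of the triple intersection,
    which [#|A : D|] divides. *)
Lemma pnat_index_trans (gT : finGroupType) (p : nat) (A B D : {group gT}) :
    B :&: D <| B -> p.-nat #|A : B| -> p.-nat #|B : D| ->
  p.-nat #|A : D|.
Proof.
move=> /andP[_ nBD_B] pAB pBD.
have pABD : p.-nat #|A :&: B : B :&: D|.
  have sABB := subsetIr A B.
  rewrite -card_quotient ?(subset_trans sABB) //.
  apply: pnat_dvd (cardSg (quotientS _ sABB)) _.
  by rewrite card_quotient // indexgI.
apply: (@pnat_dvd _ #|A : A :&: B :&: (B :&: D)|).
  exact: indexgS (subset_trans (subsetIr _ _) (subsetIr _ _)).
rewrite -(@Lagrange_index _ A (A :&: B)) ?subsetIl // pnatM.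
by rewrite !indexgI pAB.
Qed.

(** * Components when a normal primary subgroup has a controlled quotient *)

Section AbelianByPrimary.
Variables (gT : finGroupType) (p q : nat) (G U : {group gT}).
Hypothesis nUG : U <| G.

Lemma normal_of_index_pnat (B D : {group gT}) :
    q.-group U -> abelian (G / U) -> q \in p^' ->
  B \subset G -> p.-nat #|B : D| -> B :&: D <| B.
Proof.
move=> qU abGU p'q sBG pBD.
have nUB : B \subset 'N(U) := subset_trans sBG (normal_norm nUG).
have sEB : B :&: D \subset B := subsetIl B D.
have sUE : B :&: U \subset B :&: D.
  have nUE : B :&: D \subset 'N(B :&: U).
    by rewrite (subset_trans sEB) // normsI ?normG.
  have sEJ : B :&: D \subset (B :&: D) <*> (B :&: U) by apply: joing_subl.
  have sJB : (B :&: D) <*> (B :&: U) \subset B by rewrite join_subG !subsetIl.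
  (* [#|B :&: U : B :&: D|] is the index of [B :&: D] in its join with [B :&: U], so it divides
     [#|B : D|], a power of [p]. It also divides the order of the q-group [B :&: U], hence it is
     1. *)
  rewrite -indexg_eq1; apply/eqP; apply: (@pnat_1 p).
    rewrite -indexMg -norm_joinEl //.
    by apply: pnat_dvd (indexSg sEJ sJB) _; rewrite indexgI.
  apply: pnat_dvd (dvdn_indexg _ _) _.
  apply: (@sub_in_pnat q) => [r _ /eqP->//|].
  exact: pgroupS (subsetIr B U) qU.
apply: sub_der1_normal => //; apply: subset_trans sUE.
rewrite subsetI der_sub der1_min //.
exact: abelianS (quotientS U sBG) abGU.
Qed.

Lemma complete_component (C : {set subgroup_of G}) :
    q.-group U -> abelian (G / U) -> q \in p^' ->
  is_component (local_commens p G) C -> complete_on (local_commens p G) C.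
Proof.
move=> qU abGU p'q [x ->] a b; rewrite !inE => ca cb neq_ab.
(* [r] is adjacency without distinctness. Normality makes it transitive, so [r x] is constant along
   paths. *)
pose r (y z : subgroup_of G) :=
  p.-nat #|val y : val z| && p.-nat #|val z : val y|.
have nrm (y z : subgroup_of G) : p.-nat #|val y : val z| ->
    val y :&: val z <| val y.
  by apply: normal_of_index_pnat => //; apply: (valP y).
have r_tr y z t : r y z -> r z t -> r y t.
  move=> /andP[yz zy] /andP[zt tz]; apply/andP; split.
    exact: pnat_index_trans (nrm _ _ zt) yz zt.
  exact: pnat_index_trans (nrm _ _ zy) tz zy.
have eqr y z : local_commens p G y z -> r x y = r x z.
  rewrite local_commensE => /and3P[_ yz zy].
  by apply/idP/idP => [/r_tr|/r_tr]; apply; apply/andP.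
have rxx : r x x by rewrite /r indexgg.
have: r x a by rewrite -(connect_invariant eqr ca).
have: r x b by rewrite -(connect_invariant eqr cb).
rewrite local_commensE neq_ab => xb /andP[xa ax].
by apply: (r_tr _ x) xb; rewrite /r ax xa.
Qed.

Lemma star_component (C : {set subgroup_of G}) :
    prime #|U| -> p.-group U -> p^'.-group (G / U) ->
  is_component (local_commens p G) C -> star_on (local_commens p G) C.
Proof.
move=> prU pU p'GU [x ->].
have nU (y : subgroup_of G) : val y \subset 'N(U).
  exact: subset_trans (valP y) (normal_norm nUG).
(* The index between the images divides [#|val y : val z|], a power of [p], and also the order of a
   p'-group, so it is 1. *)
have sub_mod (y z : subgroup_of G) : p.-nat #|val y : val z| ->
    val y / U \subset val z / U.
  move=> pyz; rewrite -indexg_eq1; apply/eqP; apply: (@pnat_1 p).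
    apply: pnat_dvd pyz; apply: index_quotient.
    by rewrite subIset // nU.
  apply: pnat_dvd (dvdn_indexg _ _) _.
  exact: pgroupS (quotientS U (valP y)) p'GU.
have eq_mod (y z : subgroup_of G) : local_commens p G y z ->
    val y / U = val z / U.
  rewrite local_commensE => /and3P[_ yz zy].
  by apply/eqP; rewrite eqEsubset !sub_mod.
have sxUG : val x <*> U \subset G.
  by rewrite join_subG (valP x) normal_sub.
pose c : subgroup_of G := exist _ (val x <*> U)%G sxUG.
have modc : val c / U = val x / U by apply: quotientYidr.
have center (y : subgroup_of G) : connect (local_commens p G) x y ->
    U \subset val y -> y = c.
  move=> /(connect_invariant eq_mod); rewrite -modc => yc sUy.
  apply/val_inj/group_inj/esym; apply: quotient_inj yc.
    by rewrite /normal joing_subr (nU c).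
  by rewrite /normal sUy nU.
exists c => [|y z].
  (* [c] is either [x] itself or adjacent to [x], since the index of [x] in [c] divides [#|U|]. *)
  rewrite inE; have [->|nxc] := eqVneq x c; first exact: connect0.
  apply: connect1; rewrite local_commensE nxc /=; apply/andP; split.
    by move: (joing_subl (val x) U); rewrite -indexg_eq1 => /eqP->.
  rewrite norm_joinEl ?nU // indexMg.
  exact: pnat_dvd (dvdn_indexg _ _) pU.
rewrite !inE => cy cz yz.
case sUy: (U \subset val y); first by left; apply: center.
case sUz: (U \subset val z); first by right; apply: center.
(* As [U] has prime order, such a [t] meets it trivially and embeds in [G / U]. *)
have p'grp (t : subgroup_of G) : (U \subset val t) = false ->
    p^'.-group (val t).
  move=> /negbT /(prime_TIg prU) Ut1.
  rewrite /pgroup (card_isog (quotient_isog (nU t) Ut1)).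
  exact: pgroupS (quotientS U (valP t)) p'GU.
(* In a p'-group an index that is a power of [p] is 1, so adjacent p'-groups would coincide. *)
have sub (s t : subgroup_of G) : p^'.-group (val s) ->
    p.-nat #|val s : val t| -> val s \subset val t.
  move=> p's pst; rewrite -indexg_eq1; apply/eqP; apply: (pnat_1 pst).
  exact: pnat_dvd (dvdn_indexg _ _) p's.
move: yz; rewrite local_commensE => /and3P[/eqP nyz py pz].
by case: nyz; apply/val_inj/group_inj/eqP; rewrite eqEsubset !sub ?p'grp.
Qed.

End AbelianByPrimary.

(** * The unitriangular subgroup and its quotient *)

Section UpperTriangular.
Variable q : nat.

Local Notation G := (upper_GL2_group q).

Lemma upper_GL2_mul_diag (x y : {'GL_2['F_q]}) (i : 'I_2) :
  x \in G -> y \in G ->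
  GLval (x * y) i i = (GLval x i i * GLval y i i)%R.
Proof.
move=> /upper_GL2P xU /upper_GL2P yU; rewrite GL_ME mxE (bigD1 i) //=.
rewrite big1 ?GRing.addr0 // => k /negP nki.
case: (ltngtP k i) => [ki|ik|/val_inj ki].
- by rewrite xU // GRing.mul0r.
- by rewrite yU // GRing.mulr0.
- by case: nki; apply/eqP.
Qed.

Lemma upper_GL2_diag_unit (x : {'GL_2['F_q]}) (i : 'I_2) :
  x \in G -> GLval x i i \is a GRing.unit.
Proof.
move=> xG; have := upper_GL2_mul_diag i xG (groupVr xG).
rewrite mulgV GL_1E mxE eqxx => /esym xV.
rewrite GRing.unitfE; apply/eqP=> x0; move/eqP: xV.
by rewrite x0 GRing.mul0r eq_sym GRing.oner_eq0.
Qed.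

(** The default 1 is never taken on [G], where diagonal entries are units. *)
Definition diag_unit (i : 'I_2) (x : {'GL_2['F_q]}) : {unit 'F_q} :=
  insubd (1 : {unit 'F_q}) (GLval x i i).

Lemma val_diag_unit (i : 'I_2) (x : {'GL_2['F_q]}) :
  x \in G -> val (diag_unit i x) = GLval x i i.
Proof. by move=> xG; rewrite val_insubd upper_GL2_diag_unit. Qed.

Lemma diag_unitM (i : 'I_2) : {in G &, {morph diag_unit i : x y / x * y}}.
Proof.
move=> x y xG yG; apply: val_inj.
by rewrite val_diag_unit ?groupM //= !val_diag_unit // -upper_GL2_mul_diag.
Qed.

Definition diag_units (x : {'GL_2['F_q]}) : {unit 'F_q} * {unit 'F_q} :=
  (diag_unit ord0 x, diag_unit ord_max x).

Lemma diag_unitsM : {in G &, {morph diag_units : x y / x * y}}.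
Proof. by move=> x y xG yG; rewrite /diag_units !diag_unitM. Qed.

Canonical diag_units_morphism := Morphism diag_unitsM.

(** As a kernel it is normal at once, and its quotient is isomorphic to a group of pairs of field
    units. *)
Definition unitriangular : {group {'GL_2['F_q]}} := ('ker diag_units)%G.

Lemma unitriangular_normal : unitriangular <| G.
Proof. exact: ker_normal. Qed.

Lemma upper_GL2_quotient_abelian : abelian (G / unitriangular).
Proof.
rewrite (isog_abelian (first_isog diag_units_morphism)).
apply/centsP=> -[a1 a2] _ [b1 b2] _.
by congr pair; apply: val_inj; apply: GRing.mulrC.
Qed.

(** The order of the quotient divides [(q - 1) ^ 2], which is prime to [q]. *)
Lemma upper_GL2_quotient_pgroup :
  prime q -> q^'.-group (G / unitriangular).
Proof.
move=> q_pr; rewrite /pgroup (card_isog (first_isog diag_units_morphism)).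
apply: pnat_dvd (cardSg (subsetT _)) _.
rewrite cardsT card_prod -!cardsT !card_finField_unit card_Fp // pnatM andbb.
have q_gt1 := prime_gt1 q_pr.
by rewrite p'natE // gtnNdvd -?subn1 ?subn_gt0 // subn1 ltn_predL ltnW.
Qed.

Definition transvection_mx (a : 'F_q) : 'M['F_q]_2 :=
  (\matrix_(i, j) if (i < j)%N then a else (i == j)%:R)%R.

Lemma transvection_mx_unit (a : 'F_q) : transvection_mx a \in unitmx.
Proof.
rewrite unitmxE -det_tr det_trig.
  by rewrite big1 ?GRing.unitr1 // => i _; rewrite !mxE ltnn eqxx.
apply/is_trig_mxP=> i j ij; rewrite !mxE ltnNge ltnW //=.
by rewrite eq_sym -val_eqE /= ltn_eqF.
Qed.

Definition transvection (a : 'F_q) : {'GL_2['F_q]} :=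
  insubd (1 : {'GL_2['F_q]}) (transvection_mx a).

Lemma val_transvection (a : 'F_q) :
  GLval (transvection a) = transvection_mx a.
Proof.
by rewrite -[GLval _]/(val _) val_insubd [_ \in _]transvection_mx_unit.
Qed.

Lemma transvection_inj : injective transvection.
Proof.
move=> a b /(congr1 GLval); rewrite !val_transvection.
by move=> /matrixP/(_ ord0 ord_max); rewrite !mxE.
Qed.

(** This explicit form of the kernel, parametrized by the upper right entry, serves to count its
    elements. *)
Lemma unitriangularE : unitriangular :=: [set transvection a | a : 'F_q].
Proof.
apply/setP=> x; apply/idP/imsetP => [|[a _ ->]].
  case/morphpreP=> xG /set1P[d0 d1].
  exists (GLval x ord0 ord_max) => //; apply: val_inj.
  rewrite -[RHS]/(GLval _) val_transvection; apply/matrixP=> i j.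
  have x00 : GLval x ord0 ord0 = 1%R by rewrite -val_diag_unit // d0.
  have x11 : GLval x ord_max ord_max = 1%R by rewrite -val_diag_unit // d1.
  have x10 := upper_GL2P _ xG ord_max ord0 isT.
  rewrite mxE.
  have ord2P (k : 'I_2) : k = ord0 \/ k = ord_max.
    by case: k => -[|[|//]] k2; [left|right]; apply: val_inj.
  by case: (ord2P i) => ->; case: (ord2P j) => -> /=.
have tG : transvection a \in G.
  apply/upper_GL2P=> i j ji; rewrite val_transvection mxE.
  by rewrite ltnNge ltnW //= -val_eqE /= gtn_eqF.
apply/morphpreP; split=> //; apply/set1P.
by congr pair; apply: val_inj; rewrite /= val_diag_unit // val_transvection mxE.
Qed.

Lemma card_unitriangular : prime q -> #|unitriangular| = q.
Proof.
move=> q_pr; rewrite unitriangularE card_imset ?card_Fp //.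
exact: transvection_inj.
Qed.

End UpperTriangular.

Theorem theorem12 (p q : nat) (p_pr : prime p) (q_pr : prime q)
    (C : {set subgroup_of (upper_GL2_group q)}) :
  is_component (local_commens p (upper_GL2_group q)) C ->
  complete_on (local_commens p (upper_GL2_group q)) C \/
  star_on (local_commens p (upper_GL2_group q)) C.
Proof.
have nUG := unitriangular_normal q.
have cardU := card_unitriangular q_pr.
have qU : q.-group (unitriangular q) by rewrite /pgroup cardU pnat_id.
move=> compC; have [pq|neq_pq] := eqVneq p q; [right|left].
  apply: (star_component nUG) compC; rewrite ?cardU ?pq //.
  exact: upper_GL2_quotient_pgroup.
apply: (complete_component nUG qU (upper_GL2_quotient_abelian q)) compC.
by rewrite !inE eq_sym.
Qed.
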